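(* Let $G=A\oplus E$ be a B+E-group, where $E$ is elementary and every elementary direct summand of $A$ is finite. Then $G$ is generalized Bassian.
   Context: All groups are abelian. A group $G$ is Bassian (respectively, generalized Bassian) if, for every subgroup $N$ of $G$, the existence of an injective homomorphism $G\to G/N$ implies that $N=\{0\}$ (respectively, that $N$ is a direct summand of $G$). A torsion group $E$ is elementary if, for every prime $p$, its $p$-primary component $E_p$ satisfies $pE_p=0$. A group $G$ is a B+E-group if it is the direct sum of some Bassian group and some elementary group. (In the claim, the summand $A$ of the given decomposition is not assumed in advance to be Bassian.) *)

(* Defs.v *)
From HB Require Import structures.
From mathcomp Require Import all_boot all_algebra.
From mathcomp Require Import boolp classical_sets functions cardinality.

Set Implicit Arguments.
Unset Strict Implicit.
Unset Printing Implicit Defensive.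

Import GRing.Theory.
Local Open Scope ring_scope.

(* Subgroups of an abelian group are boolean predicates ([zmodClosed]); under
   excluded middle (available from [boolp]) these are all the subgroups. *)

Section Subgroup.
Variables (G : zmodType) (N : zmodClosed G).

Definition subgroup : Type := {x : G | x \in N}.

HB.instance Definition _ := SubChoice.on subgroup.
HB.instance Definition _ := [SubChoice_isSubZmodule of subgroup by <:].

End Subgroup.

Definition internal_dsum (G : zmodType) (A B : zmodClosed G) : Prop :=
  (forall x : G, x \in A -> x \in B -> x = 0) /\
  (forall x : G, exists a b : G, [/\ a \in A, b \in B & x = a + b]).

Definition direct_summand (G : zmodType) (N : zmodClosed G) : Prop :=
  exists M : zmodClosed G, internal_dsum N M.

Definition embeds_in_quotient (G : zmodType) (N : zmodClosed G) : Prop :=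
  exists f : {additive G -> Quotient.quot N}, injective f.

Definition bassian (G : zmodType) : Prop :=
  forall N : zmodClosed G, embeds_in_quotient N ->
  forall x : G, x \in N -> x = 0.

Definition generalized_bassian (G : zmodType) : Prop :=
  forall N : zmodClosed G, embeds_in_quotient N -> direct_summand N.

Definition torsion (G : zmodType) : Prop :=
  forall x : G, exists2 n : nat, (0 < n)%N & x *+ n = 0.

Definition p_primary (G : zmodType) (p : nat) (x : G) : Prop :=
  exists k : nat, x *+ (p ^ k) = 0.

Definition elementary (G : zmodType) : Prop :=
  torsion G /\
  (forall p : nat, prime p -> forall x : G, p_primary p x -> x *+ p = 0).

Definition BplusE (G : zmodType) : Prop :=
  exists B F : zmodClosed G,
    [/\ internal_dsum B F, bassian (subgroup B) & elementary (subgroup F)].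

(* Main.v *)
Require Import Defs.
From HB Require Import structures.
From mathcomp Require Import all_boot all_algebra.
From mathcomp Require Import boolp classical_sets functions cardinality.

(** Write G = B (+) F with B Bassian and F elementary, and let f be an
injection of G into G/N.

Two finiteness properties of B are needed: its torsion-free rank is finite
([bassian_fg]), and each of its p-torsion subgroups is finite
([bassian_ptorsion_finite]). Both come from one criterion
([bassian_surj_inj]): if two homomorphisms phi, psi from B to a group D
restrict to a surjection and an injection on a subgroup C of B, then phi is
injective on C. Indeed, with K the kernel of phi on C, the rule sending b to
the class of b + c, where c in C solves phi c = psi b - phi b, embeds B into
B/K. If B had infinite rank or infinite p-torsion, a suitable D that is
divisible, or injective as a module over the integers modulo some p^m, would
admit such a phi that is not injective on C.

Consequently G has finite rank, it has a finitely generated subgroup Z inside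
B with G/Z torsion, and for every subgroup Z' of B the p-torsion W of pG + Z'
is finite, because the F-component of an element of W is p-torsion and
divisible by p in F, hence zero.

The map f controls N as follows. Starting from x in N, put x_0 = x and let
x_(k+1) represent f(x_k). If r x_k lies in the span of x_0, ..., x_(k-1), then
r x = 0 ([iterate_embedding]). As the rank of G is finite, N is torsion. If
moreover the x_k can be chosen in a finite set, then x = 0; applied to W this
gives N_p cap (pG + Z') = 0 as soon as f maps Z' into the image of pG + Z'
([kernel_disjoint]). This condition holds for Z' = 0, and it holds for Z' = Z
for all but finitely many p: some m > 0 makes m f(Z) land in the image of Z,
and every p that does not divide m is suitable.

So each N_p has a complement L_p in G containing pG, and containing Z for
almost all p. The intersection of the L_p is a complement of N: every x in G
has a multiple n x in Z, so x lies in L_p for almost all p, and finitely many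
corrections by elements of the N_p bring x into all of them
([torsion_summand]). *)

Set Implicit Arguments.
Unset Strict Implicit.
Unset Printing Implicit Defensive.

Import GRing.Theory.
Local Open Scope ring_scope.
Local Open Scope quotient_scope.

(** * Subgroups as sets, and complements by Zorn's lemma *)

Definition is_subgroup (G : zmodType) (H : set G) : Prop :=
  H 0 /\ forall x y, H x -> H y -> H (x - y).

Section IsSubgroup.
Variables (G : zmodType) (H : set G).
Hypothesis sgH : is_subgroup H.

Lemma sg0 : H 0. Proof. by case: sgH. Qed.
Lemma sgB x y : H x -> H y -> H (x - y). Proof. by case: sgH => _; apply. Qed.
Lemma sgN x : H x -> H (- x).
Proof. by move=> Hx; rewrite -sub0r; apply: sgB => //; apply: sg0. Qed.
Lemma sgD x y : H x -> H y -> H (x + y).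
Proof. by move=> Hx Hy; rewrite -[y]opprK; apply: sgB => //; apply: sgN. Qed.
Lemma sgMn x n : H x -> H (x *+ n).
Proof.
by move=> Hx; elim: n => [|n IH]; rewrite ?mulr0n ?mulrS; [exact: sg0|apply: sgD].
Qed.
Lemma sgMz x (n : int) : H x -> H (x *~ n).
Proof.
by move=> Hx; case: n => n; [apply: sgMn|apply: sgN; apply: sgMn].
Qed.
Lemma sg_sum (I : Type) (r : seq I) (P : pred I) (F : I -> G) :
  (forall i, P i -> H (F i)) -> H (\sum_(i <- r | P i) F i).
Proof.
move=> HF; elim/big_ind: _ => //; first exact: sg0.
by move=> x y; apply: sgD.
Qed.

Lemma sg_absz x (k : int) : H (x *~ k) <-> H (x *+ `|k|).
Proof.
case: k => n /=; first by [].
by split=> h; rewrite -[X in H X]opprK; apply: sgN => //; rewrite ?opprK.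
Qed.

(** Bezout: an element is an integral combination of its multiples by two
coprime integers. *)
Lemma sg_coprime m n x :
  coprime m n -> H (x *+ m) -> H (x *+ n) -> H x.
Proof.
move=> /eqP cop Hm Hn; case: m cop Hm => [|m] cop Hm.
  by move: Hn; rewrite -[n]gcd0n cop mulr1n.
case: (egcdnP n (ltn0Sn m)) => km kn e _.
have -> : x = x *+ m.+1 *+ km - x *+ n *+ kn.
  by rewrite -!mulrnA mulnC e cop mulrnDr mulr1n [(n * kn)%N]mulnC addrC addKr.
by apply: sgB; apply: sgMn.
Qed.

End IsSubgroup.

Lemma sg_zmodClosed (G : zmodType) (N : zmodClosed G) :
  is_subgroup (fun x => x \in N).
Proof. by split=> [|x y]; [exact: rpred0|exact: rpredB]. Qed.

Lemma zmodClosed_sg (G : zmodType) (H : set G) :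
  is_subgroup H -> exists K : zmodClosed G, forall x, x \in K <-> H x.
Proof.
move=> sgH; pose S : {pred G} := [pred x | `[< H x >]].
have cS : zmod_closed S.
  split=> [|x y]; first by apply/asboolP; exact: sg0.
  by move=> /asboolP hx /asboolP hy; apply/asboolP; exact: sgB.
pose K : zmodClosed G := HB.pack S (GRing.isZmodClosed.Build G S cS).
by exists K => x; split; [move=> /asboolP|move=> ?; apply/asboolP].
Qed.

Section Complement.
Variables (G : zmodType) (L0 M : set G).
Hypotheses (sgL0 : is_subgroup L0) (sgM : is_subgroup M).
Hypothesis L0M : forall x, L0 x -> M x -> x = 0.

Let good (L : set G) :=
  [/\ is_subgroup L, (L0 `<=` L)%classic & forall x, L x -> M x -> x = 0].

(** Zorn's lemma for the subgroups that contain [L0] and are disjoint from [M];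
[L0] is added to each member of a chain so that the empty chain causes no harm. *)
Lemma max_disjoint : exists L, good L /\ forall L', good L' ->
  (L `<=` L')%classic -> (L' `<=` L)%classic.
Proof.
have [|L [gL mL]] :=
    @Zorn_bigcup G (fun A : set G => good (fun x => A x \/ L0 x)).
  move=> F FP tF; split; first split.
  - by right; apply: sg0.
  - move=> x y [[A FA Ax]|Lx] [[B FB By]|Ly].
    + have [AB|BA] := tF _ _ FA FB.
        have [[_ s] _ _] := FP _ FB.
        case: (s x y); [by left; apply: AB|by left|by left; exists B|by right].
      have [[_ s] _ _] := FP _ FA.
      case: (s x y); [by left|by left; apply: BA|by left; exists A|by right].
    + have [[_ s] _ _] := FP _ FA.
      by case: (s x y); [left|right|left; exists A|right].
    + have [[_ s] _ _] := FP _ FB.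
      by case: (s x y); [right|left|left; exists B|right].
    + by right; apply: sgB.
  - by move=> x; right.
  - move=> x [[A FA Ax]|Lx]; last exact: L0M.
    by have [_ _ d] := FP _ FA; apply: d; left.
exists (fun x => L x \/ L0 x); split=> // L' gL' LL'.
apply: contrapT => L'L; apply: (mL L').
  split; first by move=> x Lx; apply: LL'; left.
  by move=> L'L1; apply: L'L => x L'x; left; apply: L'L1.
case: gL' => s l d; have e x : L' x \/ L0 x -> L' x by case=> // /l.
split; first by split=> [|x y /e ? /e ?]; left; [exact: sg0|exact: sgB].
  by move=> x; right.
by move=> x /e; apply: d.
Qed.

Hypothesis dvdM : forall L, good L -> forall (p : nat) x y m, prime p ->
  L y -> M m -> x *+ p = y + m -> exists2 m', M m' & m = m' *+ p.

(** A subgroup [L] maximal among those containing [L0] and disjoint from [M] has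
[G/(L + M)] torsion, so that only prime steps remain. If [x *+ p = y + m] with
[m = m' *+ p], then [p] times [x - m'] is in [L], and by maximality
[x - m'] is in [L + M]. Divisibility of [M] is required only for the elements
[m] arising in this way, which covers divisible subgroups as well as subgroups
killed by [p] or by a power of [p]. *)
Lemma complement : exists L, good L /\
  forall x, exists y m, [/\ L y, M m & x = y + m].
Proof.
have [L [gL maxL]] := max_disjoint; exists L; split=> //.
have [sgL L0L LM] := gL.
pose S x := exists y m, [/\ L y, M m & x = y + m].
have sgS : is_subgroup S.
  split=> [|x1 x2 [y1 [m1 [? ? ->]]] [y2 [m2 [? ? ->]]]].
    by exists 0, 0; rewrite addr0; split=> //; apply: sg0.
  by exists (y1 - y2), (m1 - m2); rewrite opprD addrACA; split=> //; apply: sgB.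
have LS x : L x -> S x.
  by move=> Lx; exists x, 0; split; rewrite ?addr0 //; apply: sg0.
have MS x : M x -> S x.
  by move=> Mx; exists 0, x; split; rewrite ?add0r //; apply: sg0.
(* Adjoining an element outside L makes the subgroup meet M nontrivially. *)
have adj x : ~ L x -> exists k y, [/\ L y, M (y + x *~ k) & y + x *~ k <> 0].
  move=> nLx; apply: contrapT => nk; apply: nLx.
  apply: (maxL (fun z => exists k y, L y /\ z = y + x *~ k)).
  - split.
    + split=> [|z1 z2 [k1 [y1 [? ->]]] [k2 [y2 [? ->]]]].
        by exists 0, 0; rewrite mulr0z addr0; split=> //; apply: sg0.
      exists (k1 - k2), (y1 - y2); rewrite mulrzBr opprD addrACA; split=> //.
      exact: sgB.
    + by move=> z /L0L Lz; exists 0, z; rewrite mulr0z addr0.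
    + move=> z [k [y [Ly ->]]] Mz; apply: contrapT => nz; apply: nk.
      by exists k, y.
  - by move=> z Lz; exists 0, z; rewrite mulr0z addr0.
  - by exists 1, 0; rewrite add0r; split=> //; apply: sg0.
(* By maximality of L, the prime steps are possible inside L + M. *)
have prime_step p x : prime p -> S (x *+ p) -> S x.
  move=> pp [y [m [Ly Mm e]]]; have [m' Mm' em] := dvdM gL pp Ly Mm e.
  have Lz : L ((x - m') *+ p) by rewrite mulrnBl e -em addrK.
  suff : S (x - m') by move=> h; rewrite -[x](subrK m'); apply: sgD => //; apply: MS.
  have [/LS//|/adj[k [u [Lu Mu nu]]]] := pselect (L (x - m')).
  have Sk : S ((x - m') *+ `|k|).
    apply/sg_absz => //; rewrite -[X in S X](addKr u).
    by apply: sgD => //; [apply: sgN => //; apply: LS|apply: MS].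
  apply: (sg_coprime sgS _ Sk (LS _ Lz)).
  rewrite coprime_sym prime_coprime //; apply/negP => /dvdnP[j ek].
  apply: nu; apply: LM => //; apply: sgD => //.
  by apply/sg_absz => //; rewrite ek mulnC mulrnA; apply: sgMn.
have step n x : (0 < n)%N -> S (x *+ n) -> S x.
  elim/ltn_ind: n x => n IH x n0; have [n1 Sx|n1] := leqP n 1.
    by move: Sx; rewrite (_ : n = 1)%N ?mulr1n //; apply/eqP; rewrite eqn_leq n1.
  have pp := pdiv_prime n1; have pn := pdiv_dvd n.
  rewrite -(divnK pn) mulrnA => /(prime_step _ _ pp); apply: IH.
    by rewrite ltn_Pdiv // prime_gt1.
  by rewrite divn_gt0 ?pdiv_gt0 // dvdn_leq.
move=> x; have [/LS//|/adj[k [y [Ly My ny]]]] := pselect (L x).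
have k0 : (0 < `|k|)%N.
  rewrite absz_gt0; apply/eqP => k0; apply: ny.
  by apply: LM => //; rewrite k0 mulr0z addr0.
apply: (step _ _ k0); apply/sg_absz => //; rewrite -[X in S X](addKr y).
by apply: sgD => //; [apply: sgN => //; apply: LS|apply: MS].
Qed.

End Complement.

(** * Extension of homomorphisms and a criterion against being Bassian *)

Lemma quot_eq0 (G : zmodType) (N : zmodClosed G) x :
  (\pi_(Quotient.quot N) x == 0) = (x \in N).
Proof. by rewrite -[0](raddf0 (\pi_(Quotient.quot N))) eqmodE /= /Quotient.equiv subr0. Qed.

(** An embedding into the quotient may be given by a choice of representatives. *)
Lemma embeds_in_quotientI (G : zmodType) (N : zmodClosed G) (g : G -> G) :
  (forall x y, g (x - y) - (g x - g y) \in N) ->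
  (forall x, g x \in N -> x = 0) -> embeds_in_quotient N.
Proof.
move=> gB g0; pose f x := \pi_(Quotient.quot N) (g x).
have fB : zmod_morphism f.
  by move=> x y; apply/eqP; rewrite -subr_eq0 /f -!raddfB quot_eq0.
pose F : {additive G -> Quotient.quot N} :=
  HB.pack f (GRing.isZmodMorphism.Build _ _ f fB).
exists F; apply: raddf_inj => x /eqP; rewrite /F /= /f quot_eq0; exact: g0.
Qed.

(** Homomorphisms into [D] extend when [D] is divisible ([q = 0], where the
premise on [d] always holds), or when [D] is an injective
module over the integers modulo [q], provided that they are to kill [q B]. The
partial homomorphism is given by its graph [L0]; a complement of [0 * D] in
[B * D] that contains [L0] is the graph of an extension. *)
Lemma extend_additive (B D : zmodType) (q : nat) (L0 : set (B * D)) :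
  (forall p (d : D), prime p -> ((p %| q)%N -> d *+ (q %/ p)%N = 0) ->
     exists d', d = d' *+ p) ->
  is_subgroup L0 ->
  (forall d, L0 (0, d) -> d = 0) -> (forall b, L0 (b *+ q, 0)) ->
  exists h : {additive B -> D}, forall b d, L0 (b, d) -> h b = d.
Proof.
move=> injD sgL0 L00 L0q; pose M (z : B * D) := z.1 = 0.
have sgM : is_subgroup M.
  by split=> [|x y]; rewrite /M //= => -> ->; rewrite subr0.
have [||L [[sgL L0L LM] LMT]] := @complement _ L0 M sgL0 sgM.
- by move=> [b d] L0bd /= b0; rewrite /M /= in b0; subst b; rewrite (L00 d).
- move=> L [sgL L0L LM] p [x1 x2] y [m1 d] pp Ly; rewrite /M /= => -> e.
  have [pq|d' ed] := @injD p (d - x2 *+ p) pp.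
    (* Subtracting a multiple of p, the second component becomes killed by q / p. *)
    suff : L (0, (d - x2 *+ p) *+ (q %/ p)%N) by move=> /LM -/(_ erefl) [].
    have -> : (0, (d - x2 *+ p) *+ (q %/ p)%N) =
        (x1 *+ q, 0) - y *+ (q %/ p)%N :> B * D.
      have -> : y = (x1 *+ p, x2 *+ p - d).
        by rewrite -[y](addrK (0, d)) -e; congr pair; rewrite /= ?raddfMn ?subr0.
      congr pair.
        rewrite /= (raddfMn fst) /= -mulrnA mulnC divnK // subrr //.
      by rewrite /= (raddfMn snd) /= sub0r -[RHS]mulNrn opprB.
    by apply: sgB => //; [exact: L0L|exact: sgMn].
  exists (0, d' + x2); first by [].
  apply: injective_projections => /=; first by rewrite (raddfMn fst) /= mul0rn.
  by rewrite (raddfMn snd) /= mulrnDl -ed subrK.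
have ex b : exists d, L (b, d).
  have [[y1 y2] [[m1 d] [Ly]]] := LMT (b, 0); rewrite /M /= => -> [eb _].
  by exists y2; rewrite eb addr0.
have [h Lh] := choice ex.
have uniq b d : L (b, d) -> h b = d.
  move=> Lbd; apply/eqP; rewrite -subr_eq0; apply/eqP.
  have : L (0, h b - d) by rewrite -[0](subrr b); exact: (sgB sgL (Lh b) Lbd).
  by move=> /LM -/(_ erefl) [].
have hB : zmod_morphism h.
  by move=> x y; apply: uniq; exact: (sgB sgL (Lh x) (Lh y)).
pose H : {additive B -> D} := HB.pack h (GRing.isZmodMorphism.Build _ _ h hB).
by exists H => b d /L0L; exact: uniq.
Qed.

(** The kernel [N] of [phi] on [C] must vanish: sending [b] to the class of
[b + r b], where [r b] in [C] satisfies [phi (r b) = psi b - phi b], is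
well-defined and additive modulo [N]. If [b + r b] is in [N] then [b] is in
[C] and [psi b = phi (b + r b) = 0], so that [b = 0]. *)
Lemma bassian_surj_inj (B D : zmodType) (phi psi : {additive B -> D})
    (C : set B) :
  bassian B -> is_subgroup C ->
  (forall d, exists2 c, C c & phi c = d) ->
  (forall c, C c -> psi c = 0 -> c = 0) ->
  forall c, C c -> phi c = 0 -> c = 0.
Proof.
move=> bB sgC surj inj c Cc c0.
have [N NP] : exists N : zmodClosed B, forall x, x \in N <-> C x /\ phi x = 0.
  apply: zmodClosed_sg; split=> [|x y [Cx x0] [Cy y0]].
    by rewrite raddf0; split=> //; apply: sg0.
  by rewrite raddfB x0 y0 subr0; split=> //; apply: sgB.
apply: (bB N); last exact/NP.
have /choice[r rP] b : exists r, C r /\ phi r = psi b - phi b.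
  by have [r] := surj (psi b - phi b); exists r.
apply: (@embeds_in_quotientI _ _ (fun b => b + r b)) => [x y|x].
  have [Cx ex] := rP x; have [Cy ey] := rP y; have [Cxy exy] := rP (x - y).
  have -> : x - y + r (x - y) - (x + r x - (y + r y)) = r (x - y) - (r x - r y).
    rewrite [X in _ - X](_ : _ = x - y + (r x - r y)); last first.
      by rewrite opprD addrACA.
    by rewrite [x - y + r _]addrC addrKA.
  apply/NP; split; first by do !apply: sgB => //.
  apply/eqP; rewrite raddfB exy subr_eq0 (raddfB phi (r x)) ex ey !raddfB /=.
  by rewrite addrACA.
move=> /NP [Cx]; rewrite raddfD; have [Cr ->] := rP x.
rewrite addrC subrK; apply: inj.
by rewrite -[x](addrK (r x)); apply: sgB.
Qed.

(** * Sequences of elements, and finite torsion-free rank of Bassian groups *)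

(** Dependent choice for sequences in which the condition on the [k]-th term
involves the terms before it. *)
Lemma greedy (G : zmodType) (R : nat -> (nat -> G) -> G -> Prop) :
  (forall k c c' x, (forall i, (i < k)%N -> c i = c' i) -> R k c x -> R k c' x) ->
  (forall k c, (forall i, (i < k)%N -> R i c (c i)) -> exists x, R k c x) ->
  exists c, forall k, R k c (c k).
Proof.
move=> Rext Rex.
have [g gP] : exists g : nat * (nat -> G) -> G, forall kc, 
    (forall i, (i < kc.1)%N -> R i kc.2 (kc.2 i)) -> R kc.1 kc.2 (g kc).
  have h (kc : nat * (nat -> G)) : exists x,
      (forall i, (i < kc.1)%N -> R i kc.2 (kc.2 i)) -> R kc.1 kc.2 x.
    have [/Rex[x Rx]|n] := pselect (forall i, (i < kc.1)%N -> R i kc.2 (kc.2 i)).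
      by exists x.
    by exists 0.
  by have [g gP] := choice h; exists g.
pose F := fix F k := if k is k'.+1 then
   fun i => if (i == k')%N then g (k', F k') else F k' i else fun=> 0.
pose c k := g (k, F k).
have Fc k i : (i < k)%N -> F k i = c i.
  elim: k => // k IH; rewrite ltnS leq_eqVlt /= => /orP[/eqP->|ik].
    by rewrite eqxx.
  by rewrite ltn_eqF // IH.
exists c => k; have : R k (F k) (c k).
  elim/ltn_ind: k => k IH; apply: (gP (k, F k)) => i /= ik.
  rewrite Fc //; apply: Rext (IH _ ik) => j ji.
  by rewrite !Fc // (ltn_trans ji).
by apply: Rext => i /Fc.
Qed.

(** Coefficients are stored in integer polynomials, the free abelian group on
countably many generators, so that combinations of any length form an additive
function of one argument. *)
Definition comb (G : zmodType) (c : nat -> G) (P : {poly int}) : G :=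
  \sum_(i < size P) c i *~ P`_i.

Definition nspan (G : zmodType) (c : nat -> G) (k : nat) : set G :=
  [set x | exists2 P : {poly int}, (size P <= k)%N & x = comb c P]%classic.

Section Comb.
Variables (G : zmodType).
Implicit Types (c : nat -> G) (P : {poly int}).

Lemma comb_widen c P n :
  (size P <= n)%N -> comb c P = \sum_(i < n) c i *~ P`_i.
Proof.
move=> sP; rewrite /comb (big_ord_widen _ (fun i => c i *~ P`_i) sP) big_mkcond.
apply: eq_bigr => i _; case: ltnP => // hi.
by rewrite nth_default // mulr0z.
Qed.

Lemma combB c P Q : comb c (P - Q) = comb c P - comb c Q.
Proof.
pose n := maxn (size P) (size Q).
have sPQ : (size (P - Q)%R <= n)%N by rewrite (leq_trans (size_polyD _ _)) // size_polyN.
rewrite !(@comb_widen c _ n) ?leq_maxl ?leq_maxr // -sumrB.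
by apply: eq_bigr => i _; rewrite coefB mulrzBr.
Qed.

Lemma comb0 c : comb c 0 = 0. Proof. by rewrite /comb size_poly0 big_ord0. Qed.
Lemma combN c P : comb c (- P) = - comb c P.
Proof. by rewrite -[- P]sub0r combB comb0 sub0r. Qed.
Lemma combD c P Q : comb c (P + Q) = comb c P + comb c Q.
Proof. by rewrite -{1}[Q]opprK combB combN opprK. Qed.
Lemma combZXn c k r : comb c (r *: 'X^k) = c k *~ r.
Proof.
have sP : (size (r *: 'X^k : {poly int})%R <= k.+1)%N.
  by rewrite (leq_trans (size_scale_leq _ _)) // size_polyXn.
rewrite (comb_widen _ sP) big_ord_recr /= big1 ?add0r => [|i _].
  by rewrite coefZ coefXn eqxx mulr1.
by rewrite coefZ coefXn ltn_eqF ?mulr0 ?mulr0z.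
Qed.
Lemma combXn c k : comb c 'X^k = c k.
Proof. by rewrite -[_^+_]scale1r combZXn. Qed.

Lemma comb_dvd c (o : nat -> nat) P :
  (forall k, c k *+ o k = 0) -> (forall k, (o k %| P`_k)%Z) -> comb c P = 0.
Proof.
move=> co oP; rewrite /comb big1 // => i _; have /dvdzP[r ->] := oP i.
by rewrite mulrC mulrzA -pmulrn co mul0rz.
Qed.

Lemma sg_comb c (H : set G) P :
  is_subgroup H -> (forall k, (k < size P)%N -> H (c k)) -> H (comb c P).
Proof. by move=> sgH Hc; apply: sg_sum => // i _; apply: sgMz => //; apply: Hc. Qed.

Lemma sg_nspan c k : is_subgroup (nspan c k).
Proof.
split; first by exists 0; rewrite ?size_poly0 ?comb0.
move=> x y [P sP ->] [Q sQ ->]; exists (P - Q); last by rewrite combB.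
by rewrite (leq_trans (size_polyD _ _)) // size_polyN geq_max sP.
Qed.

Lemma nspan_mem c k i : (i < k)%N -> nspan c k (c i).
Proof. by move=> ik; exists 'X^i; rewrite ?size_polyXn ?combXn. Qed.

Lemma nspan_sub c k (H : set G) :
  is_subgroup H -> (forall i, (i < k)%N -> H (c i)) -> (nspan c k `<=` H)%classic.
Proof.
move=> sgH Hc x [P sP ->]; apply: sg_comb => // i /leq_trans; move/(_ _ sP).
exact: Hc.
Qed.

Lemma eq_nspan c c' k :
  (forall i, (i < k)%N -> c i = c' i) -> nspan c k = nspan c' k.
Proof.
move=> e; apply/seteqP; split; (apply: nspan_sub; first exact: sg_nspan) => i ik.
  by rewrite e //; apply: nspan_mem.
by rewrite -e //; apply: nspan_mem.
Qed.

(** For [o = q = 0] this is linear independence over the integers; for [o] prime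
and terms killed by [o], it is linear independence modulo [q B] over the field
with [o] elements. *)
Definition indep_mod (o q : nat) c : Prop :=
  forall k (r : int) b, nspan c k (c k *~ r + b *+ q) -> (o %| r)%Z.

(** Descending induction on the last coefficient, which independence makes
divisible by [o], so that the last term vanishes. *)
Lemma indep_comb o q c : indep_mod o q c -> (forall k, c k *+ o = 0) ->
  forall P b, comb c P = b *+ q -> forall k, (o %| P`_k)%Z.
Proof.
move=> ind co P; move: (leqnn (size P)); move: {2}(size P) => n.
elim: n P => [|n IH] P sP b e k.
  by rewrite nth_default ?dvdz0 // (leq_trans sP).
have defP : P = take_poly n P + P`_n *: 'X^n.
  apply/polyP => i; rewrite coefD coefZ coefXn coef_take_poly.
  case: ltngtP => [|ni|->]; rewrite ?mulr0 ?addr0 ?mulr1 ?add0r //.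
  by rewrite nth_default // (leq_trans sP).
have eP : comb c P = comb c (take_poly n P) + c n *~ P`_n.
  by rewrite [in LHS]defP combD combZXn.
have oPn : (o %| P`_n)%Z.
  apply: (ind n _ (- b)); exists (- take_poly n P).
    by rewrite size_polyN size_take_poly.
  by rewrite combN mulNrn -e eP opprD addrCA subrr addr0.
have {}e : comb c (take_poly n P) = b *+ q.
  rewrite -e eP; have /dvdzP[r ->] := oPn.
  by rewrite mulrC mulrzA -pmulrn co mul0rz addr0.
have := IH _ _ _ e k; rewrite size_take_poly => /(_ isT).
rewrite coef_take_poly; case: ltngtP => [//|nk _|-> _ //].
by rewrite nth_default ?dvdz0 // (leq_trans sP).
Qed.

End Comb.

Lemma raddf_comb (G G' : zmodType) (f : {additive G -> G'}) c P :
  f (comb c P) = comb (f \o c) P.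
Proof. by rewrite raddf_sum; apply: eq_bigr => i _; rewrite raddfMz. Qed.

Section Seq.
Variables (B D : zmodType) (q : nat) (o : nat -> nat).
Hypothesis injD : forall p (d : D), prime p ->
  ((p %| q)%N -> d *+ (q %/ p)%N = 0) -> exists d', d = d' *+ p.
Variable c : nat -> B.
Hypothesis c_ind : forall P b, comb c P = b *+ q -> forall k, (o k %| P`_k)%Z.

Lemma extend_seq (e : nat -> D) : (forall k, e k *+ o k = 0) ->
  exists h : {additive B -> D}, forall k, h (c k) = e k.
Proof.
move=> eo; pose L0 (z : B * D) := exists P b, z = (comb c P + b *+ q, comb e P).
have [|d [P [b [e0 ->]]]|b|h hP] := @extend_additive B D q L0 injD.
- split=> [|_ _ [P [b ->]] [P' [b' ->]]].
    by exists 0, 0; rewrite !comb0 mul0rn addr0.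
  exists (P - P'), (b - b'); rewrite !combB mulrnBl addrACA -opprD //.
- apply: comb_dvd eo _; apply: (@c_ind P (- b)).
  by apply/eqP; rewrite mulNrn -addr_eq0 -e0.
- by exists 0, b; rewrite !comb0 add0r.
- exists h => k; apply: hP; exists 'X^k, 0.
  by rewrite !combXn mul0rn addr0.
Qed.

(** Independence makes [c k |-> e k] and [c k |-> d k] extend to homomorphisms on
[B]; on the span of [c] the first is injective and the second is onto. As the
second sends [c 0] to [0], the criterion for Bassian groups gives [c 0 = 0]. *)
Lemma bassian_seq0 (e d : nat -> D) : bassian B ->
  (forall k, c k *+ o k = 0) ->
  (forall k, e k *+ o k = 0) ->
  (forall P, comb e P = 0 -> forall k, (o k %| P`_k)%Z) ->
  (forall k, d k *+ o k = 0) -> (forall x, exists k, d k = x) ->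
  d 0 = 0 -> c 0 = 0.
Proof.
move=> bB co eo e_ind dO surjd d0.
have [psi psiP] := extend_seq eo; have [phi phiP] := extend_seq dO.
apply: (@bassian_surj_inj B D phi psi (range (comb c))) => //.
- split=> [|_ _ [P _ <-] [Q _ <-]]; first by exists 0; rewrite ?comb0.
  by exists (P - Q); rewrite ?combB.
- by move=> x; have [k <-] := surjd x; exists (c k) => //; exists 'X^k; rewrite ?combXn.
- move=> _ [P _ <-] e0; apply: comb_dvd co _; apply: e_ind.
  rewrite -e0 raddf_comb; congr comb; apply/funext => k /=; by rewrite psiP.
- by exists 'X^0; rewrite ?combXn.
- by rewrite phiP.
Qed.

End Seq.

(** A free subgroup of countable rank embeds into the countable divisible group
of rational polynomials, via [c k |-> 'X^k], and also maps onto it, by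
enumerating its elements. *)
Lemma bassian_finite_rank (B : zmodType) (c : nat -> B) :
  bassian B -> ~ indep_mod 0 0 c.
Proof.
move=> bB ind; suff c0 : c 0 = 0.
  suff : (0%N %| 1)%Z by [].
  by apply: (ind 0 1 0); rewrite c0 addr0; apply: (sg0 (sg_nspan c 0)).
pose d k : {poly rat} := if k is k'.+1 then odflt 0 (unpickle k') else 0.
apply: (@bassian_seq0 B {poly rat} 0 (fun=> 0) _ c _ (fun k => 'X^k) d) => //.
- move=> p x pp _; exists (p%:R^-1 *: x).
  rewrite -scaler_nat scalerA mulfV ?scale1r //.
  by rewrite Num.Theory.pnatr_eq0 -lt0n prime_gt0.
- exact: indep_comb.
- move=> P P0 k; have : map_poly intr P = 0 :> {poly rat}.
    rewrite -P0 /comb -[in LHS](coefK P) poly_def raddf_sum /=.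
    apply: eq_bigr => i _; rewrite map_polyZ map_polyXn scaler_int //.
  move/polyP/(_ k); rewrite coef_map coef0 => /eqP; rewrite intr_eq0 => /eqP->.
  exact: dvdz0.
- by move=> x; exists (pickle x).+1; rewrite /= pickleK.
Qed.

(** * Independent sequences of p-power order in Bassian groups *)

Lemma valMn (G : zmodType) (N : zmodClosed G) (x : subgroup N) n :
  val (x *+ n) = val x *+ n.
Proof. exact: raddfMn. Qed.

(** For use on enumerations: every element occurs at arbitrarily large indices. *)
Lemma injective_unbounded (g : nat -> nat) K :
  injective g -> exists i, (K <= g i)%N.
Proof.
move=> injg; apply: contrapT => nex.
suff : (size (map g (iota 0 K.+1)) <= size (iota 0 K))%N.
  by rewrite size_map !size_iota ltnn.
apply: uniq_leq_size; first by rewrite map_inj_uniq ?iota_uniq.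
move=> _ /mapP[i _ ->]; rewrite mem_iota add0n /= ltnNge.
by apply/negP => Ki; apply: nex; exists i.
Qed.

Lemma mulrn_dvd (G : zmodType) (x : G) m n :
  (m %| n)%N -> x *+ m = 0 -> x *+ n = 0.
Proof. by move=> /dvdnP[k ->] xm; rewrite mulnC mulrnA xm mul0rn. Qed.

Section PSeq.
Variables (p : nat) (n : nat -> nat) (q : nat).
Hypotheses (pp : prime p) (monon : {homo n : i j / (i <= j)%N}).
Hypothesis qP : (q = 0%N /\ forall m, exists k, (m <= n k)%N) \/
                (exists2 m, q = (p ^ m.+1)%N & forall k, n k = m).

Let o k := (p ^ (n k).+1)%N.
Let o_gt0 k : (0 < o k)%N. Proof. by rewrite expn_gt0 prime_gt0. Qed.

(** Independence of the elements [c k *+ p ^ n k] of order [p] makes the cyclic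
groups generated by the [c k] independent: multiply a relation by a power of [p]
that makes it trivial, then remove the factors [p] one at a time. *)
Lemma pindep_comb (B : zmodType) (c : nat -> B) :
  (forall k, c k *+ o k = 0) -> indep_mod p q (fun k => c k *+ p ^ n k) ->
  forall P b, comb c P = b *+ q -> forall k, (o k %| P`_k)%Z.
Proof.
move=> co ind P b e.
have sp k : c k *+ p ^ n k *+ p = 0 by rewrite -mulrnA -expnSr co.
suff claim i k : (o k %| P`_k * (p ^ i)%N)%Z.
  by move=> k; have := claim 0%N k; rewrite mulr1.
(* Above size P the coefficients vanish; below it, n is at most n (size P). *)
have big j : ((n (size P)).+1 <= j)%N -> forall k, (o k %| P`_k * (p ^ j)%N)%Z.
  move=> ij k'; have [sk|ks] := leqP (size P) k'.
    by rewrite nth_default // mul0r dvdz0.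
  apply: dvdz_mull; rewrite dvdzE /= dvdn_exp2l // (leq_trans _ ij) // ltnS.
  by rewrite monon // ltnW.
have [t] := ubnP ((n (size P)).+1 - i)%N; elim: t i k => // t IH i k.
have [/big h _|ilt] := leqP (n (size P)).+1 i; first exact: h.
rewrite subSn // ltnS => it; have {it}it : (((n (size P)).+1 - i.+1) < t)%N.
  by rewrite subSS.
have /choice[r rP] k' : exists r : int, P`_k' * (p ^ i)%N = r * (p ^ n k')%N.
  have /dvdzP[r er] := IH i.+1 k' it; exists r.
  have p0 : (p : int) != 0 by rewrite -lt0n prime_gt0.
  by apply: (mulIf p0); rewrite -!mulrA -!PoszM -!expnSr.
have [ks|sk] := ltnP k (size P); last by rewrite nth_default // mul0r dvdz0.
have := indep_comb ind sp (P := \poly_(j < size P) r j) (b := b *+ p ^ i) _ k.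
rewrite coef_poly ks rP => h; rewrite mulrC /o expnSr PoszM dvdz_mul //.
apply: h; rewrite (comb_widen _ (size_poly _ _)).
rewrite -mulrnA mulnC mulrnA -e /comb -sumrMnl; apply: eq_bigr => j _.
rewrite coef_poly ltn_ord (pmulrn (c j)) -mulrzA mulrC -rP.
by rewrite mulrzA -pmulrn.
Qed.

(** The target [D] consists of the elements of [Q[X]/Z[X]] killed by some
[p ^ (n k).+1]. If [n] is unbounded then [D] is the divisible group
[Z(p^oo)^(omega)]; if [n] is constant then [D] is the homogeneous group
[(Z/p^m.+1)^(omega)]. Each [c k] goes to [p ^- (n k).+1 'X^k] under the
injective map; the surjective one kills [c 0] and enumerates [D], postponing an
element until the order of [c k] is large enough. *)
Lemma bassian_no_pseq (B : zmodType) (c : nat -> B) : bassian B ->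
  (forall k, c k *+ o k = 0) -> ~ indep_mod p q (fun k => c k *+ p ^ n k).
Proof.
move=> bB co ind; suff c0 : c 0%N = 0.
  suff : (p %| 1)%Z by rewrite dvdzE /= dvdn1; case: eqP pp => // ->.
  by apply: (ind 0%N 1 0); rewrite c0 !mul0rn mul0rz addr0; apply: (sg0 (sg_nspan _ 0)).
pose Zx := fun f : {poly rat} => forall k, f`_k \is a Num.int.
have [ZX ZXP] : exists N : zmodClosed {poly rat}, forall x, x \in N <-> Zx x.
  apply: zmodClosed_sg; split=> [k|x y hx hy k]; first by rewrite coef0 rpred0.
  by rewrite coefB rpredB.
pose Q := Quotient.quot ZX; pose pr : {additive {poly rat} -> Q} := \pi_Q.
have pr0 f : pr f = 0 <-> Zx f by rewrite -ZXP -quot_eq0; split=> /eqP.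
pose HD := fun x : Q => exists k, x *+ o k = 0.
have dvdo i j : (i <= j)%N -> (o i %| o j)%N.
  by move=> ij; rewrite dvdn_exp2l // ltnS monon.
have [DD DP] : exists N : zmodClosed Q, forall x, x \in N <-> HD x.
  apply: zmodClosed_sg; split=> [|x y [i xi] [j yj]].
    by exists 0%N; rewrite mul0rn.
  exists (maxn i j); rewrite mulrnBl.
  rewrite (mulrn_dvd _ xi) ?(mulrn_dvd _ yj) ?subrr ?dvdo ?leq_maxl ?leq_maxr //.
pose D := subgroup DD.
pose inD x (h : HD x) : D := exist _ x ((DP x).2 h).
have valD (y : D) : HD (val y) by apply/DP/valP.
have Dtor (y : D) : exists k, y *+ o k = 0.
  by have [k yk] := valD y; exists k; apply: val_inj; rewrite valMn yk.
have p0 (R := rat) : (p%:R : R) != 0.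
  by rewrite Num.Theory.pnatr_eq0 -lt0n prime_gt0.
have injD l (y : D) : prime l -> ((l %| q)%N -> y *+ (q %/ l)%N = 0) ->
    exists d', d' *+ l = y.
  move=> pl hl; have [k yk] := Dtor y.
  pose H (z : D) := exists d', d' *+ l = z.
  have sgH : is_subgroup H.
    split=> [|_ _ [x <-] [z <-]]; first by exists 0; rewrite mul0rn.
    by exists (x - z); rewrite mulrnBl.
  have [lp|lp] := eqVneq l p; last first.
    apply: (sg_coprime sgH (m := l) (n := o k)).
    - by rewrite coprimeXr // prime_coprime // dvdn_prime2.
    - by exists y.
    - by rewrite yk; apply: sg0.
  pose x' := pr (p%:R^-1 *: repr (val y)).
  have x'p : x' *+ p = val y.
    rewrite -raddfMn /= -scaler_nat scalerA mulfV // scale1r.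
    exact: reprK.
  have hx' : HD x'.
    case: qP => [[_ unb]|[m em nm]].
      have [k' kk'] := unb (n k).+1; exists k'.
      apply: (@mulrn_dvd _ _ (p * o k)); last by rewrite mulrnA x'p -valMn yk.
      by rewrite -expnS dvdn_exp2l.
    exists 0%N; rewrite /o nm expnS mulrnA x'p -valMn.
    move: hl; rewrite lp em expnS dvdn_mulr // mulKn ?prime_gt0 // => -> //.
  by exists (inD x' hx'); apply: val_inj; rewrite valMn lp.
have He k : pr ((o k)%:R^-1 *: 'X^k) *+ o k = 0.
  rewrite -raddfMn -scaler_nat scalerA mulfV ?scale1r.
    by apply/pr0 => j; rewrite coefXn rpred_nat.
  by rewrite Num.Theory.pnatr_eq0 -lt0n.
pose e k := inD _ (ex_intro _ k (He k)).
(* Pairing with a number makes each element of D occur at infinitely many k. *)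
pose u k : Q := if k is k'.+1 then
  let x := if (unpickle k' : option (nat * {poly rat})) is Some (_, f) then pr f else 0 in
  if x *+ o k == 0 then x else 0 else 0.
have Hu k : u k *+ o k = 0.
  case: k => [|k]; first by rewrite mul0rn.
  by rewrite /u; case: ifP => [/eqP|]; rewrite ?mul0rn.
pose d k := inD _ (ex_intro _ k (Hu k)).
apply: (@bassian_seq0 B D q o _ c _ e d) => //.
- by move=> l y pl /(injD l y pl) [d' <-]; exists d'.
- exact: pindep_comb.
- by move=> k; apply: val_inj; rewrite valMn; exact: He.
- move=> P /(congr1 val); rewrite (raddf_comb val) /= => e0 k.
  have : pr (\sum_(i < size P) ((P`_i)%:~R / (o i)%:R) *: 'X^i) = 0.
    rewrite -[RHS]e0 raddf_sum /=; apply: eq_bigr => i _ /=.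
    rewrite -raddfMz /= -scaler_int scalerA //.
  move/pr0 => /(_ k); have [sk|ks] := leqP (size P) k.
    by move=> _; rewrite nth_default ?dvdz0.
  rewrite -(poly_def _ (fun i => (P`_i)%:~R / (o i)%:R)) coef_poly ks.
  move=> /Num.Theory.intrP[z ez]; apply/dvdzP; exists z.
  apply/eqP; rewrite -(eqr_int rat) intrM -ez divfK //.
  by rewrite Num.Theory.pnatr_eq0 -lt0n.
- by move=> k; apply: val_inj; rewrite valMn; exact: Hu.
- move=> y; have [K yK] := Dtor y; pose f := repr (val y).
  have [|i Ki] := @injective_unbounded (fun i => pickle (i, f)) K.
    by move=> i j /(pcan_inj pickleK) [].
  exists (pickle (i, f)).+1; apply: val_inj => /=.
  rewrite pickleK (_ : pr f = val y); last exact: reprK.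
  by rewrite (@mulrn_dvd _ _ (o K)) ?eqxx // ?dvdo ?(leqW Ki) // -valMn yK.
- exact: val_inj.
Qed.

End PSeq.

(** * Finiteness of the p-torsion of Bassian groups *)

Lemma finite_span (G : zmodType) (s : nat -> G) p k : (0 < p)%N ->
  (forall i, (i < k)%N -> s i *+ p = 0) -> finite_set (nspan s k).
Proof.
move=> p0 sp; apply: (sub_finite_set (B :=
  [set \sum_(i < k) s i *+ a i | a in [set: {ffun 'I_k -> 'I_p}]]%classic));
  last exact/finite_image/finite_finset.
have pz : (p : int) != 0 by rewrite -lt0n.
move=> x [P sP ->]; rewrite (comb_widen _ sP).
have lt_mod (i : 'I_k) : (`|P`_i %% p|%Z < p)%N.
  by rewrite -ltz_nat gez0_abs ?modz_ge0 // ltz_pmod.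
exists [ffun i : 'I_k => Ordinal (lt_mod i)] => //.
apply: eq_bigr => i _; rewrite ffunE /= pmulrn gez0_abs ?modz_ge0 //.
symmetry; rewrite {1}(divz_eq P`_i p) [LHS]mulrzDr [(_ %/ _)%Z * _]mulrC mulrzA -pmulrn sp // mul0rz.
by rewrite add0r.
Qed.

Section Socle.
Variables (B : zmodType) (p : nat).
Hypotheses (bB : bassian B) (pp : prime p).

Let S n : set B := [set x | x *+ p = 0 /\ exists y, x = y *+ p ^ n]%classic.

(** The terms of index below [k] span a finite group, and the socle meets [q B] in
a finite set, so only finitely many elements of [S (n k)] are excluded at step
[k]. *)
Lemma socle_seq (n : nat -> nat) q :
  (forall k, ~ finite_set (S (n k))) ->
  finite_set [set x : B | x *+ p = 0 /\ exists b, x = b *+ q]%classic ->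
  exists c : nat -> B, (forall k, c k *+ p ^ (n k).+1 = 0) /\
    indep_mod p q (fun k => c k *+ p ^ n k).
Proof.
move=> infS finq.
have p0 := prime_gt0 pp.
have [|k s sR|s sR] := @greedy B
  (fun k s x => S (n k) x /\ ~ exists b, nspan s k (x + b *+ q)).
- by move=> k s s' x /eq_nspan ->.
- apply: contrapT => nex; apply: (infS k).
  pose T := [set y - z | y in nspan s k &
    z in [set x : B | x *+ p = 0 /\ exists b, x = b *+ q]]%classic.
  apply: (@sub_finite_set _ _ T); last first.
    apply: finite_image2 => //; apply: finite_span p0 _ => i /sR[[]] //.
  move=> x Sx; have [b xb] : exists b, nspan s k (x + b *+ q).
    by apply: contrapT => nb; apply: nex; exists x.
  exists (x + b *+ q) => //; exists (b *+ q); last by rewrite addrK.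
  split; last by exists b.
  have sgp : is_subgroup (fun x : B => x *+ p = 0).
    by split=> [|? ? ? e]; rewrite ?mul0rn // mulrnBl e subr0.
  have hxb : (x + b *+ q) *+ p = 0.
    by apply: (nspan_sub sgp _ xb) => i /sR[[]].
  by move: hxb; rewrite mulrnDl Sx.1 add0r.
have /choice[c cP] k : exists c, s k = c *+ p ^ n k by have [[]] := sR k.
exists c; split=> [k|]; first by rewrite expnSr mulrnA -cP; have [[]] := sR k.
rewrite (_ : (fun k => _) = s); last by apply/funext => k; rewrite cP.
move=> k r b rb; apply: contrapT => /negP npr; have [[sp _] nspan] := sR k.
(* When p does not divide r, a Bezout relation would put s k itself in the span modulo q B. *)
have cop : coprimez r p.
  by rewrite coprimezE /= coprime_sym prime_coprime.
apply: nspan; have [[u v] /= uv] := coprimezP _ _ cop.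
exists (b *~ u).
have -> : s k + b *~ u *+ q = (s k *~ r + b *+ q) *~ u.
  rewrite mulrzDl -mulrzA -[LHS]addr0 -{1}[s k]mulr1z -uv mulrzDr.
  rewrite [v * p]mulrC [s k *~ (_ * v)]mulrzA -pmulrn sp mul0rz addr0 addr0.
  by rewrite [r * u]mulrC !pmulrn -!mulrzA mulrC [q%:Z * u]mulrC.
by apply: sgMz => //; apply: sg_nspan.
Qed.

(** Suppose that the socle is infinite. If infinitely many of its elements have
height at least [n] for every [n], there are independent cyclic subgroups of
unbounded orders. Otherwise let [m] be the largest height for which this holds:
then there are infinitely many independent cyclic subgroups of order [p ^ m.+1],
independent modulo [p ^ m.+1 B]. Both cases are excluded in Bassian groups. *)
Lemma bassian_socle_finite : finite_set [set x : B | x *+ p = 0]%classic.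
Proof.
rewrite (_ : mkset _ = S 0%N); last first.
  by apply/seteqP; split=> x; [move=> xp; split=> //; exists x|case].
apply: contrapT => inf0.
have [allinf|/existsNP] := pselect (forall n, ~ finite_set (S n)).
  have [||c [co]] := @socle_seq id 0 => //.
    apply: (@sub_finite_set _ _ [set 0]%classic); last exact: finite_set1.
    by move=> x [_ [b ->]].
  apply: bassian_no_pseq => //; left; split=> // m; exists m; exact: leqnn.
move=> exfin; have {exfin} exfin : exists n, `[< finite_set (S n) >].
  by case: exfin => n /contrapT h; exists n; apply/asboolP.
case: (ex_minnP exfin) => [[|m] /asboolP fm minm] //.
have [k||c [co]] := @socle_seq (fun=> m) (p ^ m.+1) => //.
  by move=> fk; have := minm m (introT (asboolP _) fk); rewrite ltnn.
apply: bassian_no_pseq => //; right; by exists m.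
Qed.

(** Compactness of a finite set. *)
Lemma finite_decreasing (T : eqType) (F : set T) (Q : nat -> set T) :
  finite_set F -> (forall n x, Q n.+1 x -> Q n x) ->
  (forall n, exists2 x, F x & Q n x) -> exists2 x, F x & forall n, Q n x.
Proof.
move=> /finite_seqP[s ->] Qdec Qex; apply: contrapT => nex.
have Qle m n x : (m <= n)%N -> Q n x -> Q m x.
  by move=> /subnK <-; elim: (n - m)%N => // t IH /Qdec /IH.
have /choice[N NP] x : exists n, x \in s -> ~ Q n x.
  apply: contrapT => nn; apply: nex; exists x => [|n]; apply: contrapT => h.
    by apply: nn; exists 0%N.
  by apply: nn; exists n.
have [x xs Qx] := Qex (\max_(y <- s) N y).
apply: (NP x xs); apply: Qle Qx; exact: leq_bigmax_seq.
Qed.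

(** A fibre of multiplication by [p] is empty or a coset of the socle. *)
Lemma finite_pdiv (y : B) :
  finite_set [set x : B | x *+ p = 0]%classic ->
  finite_set [set x : B | x *+ p = y]%classic.
Proof.
move=> sfin.
have [[z0 ez0]|nex] := pselect (exists z0, z0 *+ p = y); last first.
  apply: (@sub_finite_set _ _ set0); last exact: finite_set0.
  by move=> z ez; apply: nex; exists z.
apply: (@sub_finite_set _ _ [set z0 + s | s in [set x | x *+ p = 0]]%classic).
  move=> z /= ez; exists (z - z0); last by rewrite addrC subrK.
  by rewrite /= mulrnBl ez ez0 subrr.
exact: finite_image.
Qed.

(** The p-torsion elements of infinite height form a subgroup [D], which is
p-divisible because the fibres of multiplication by [p] are finite. The identity
of [D] extends to a homomorphism from [B] to the divisible group [D];
comparing it with its multiple by [p] shows that [D] has no p-torsion, so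
[D = 0]. Then the heights of the nonzero elements of the finite socle are
bounded, the p-torsion has bounded exponent, and it is finite. *)
Lemma bassian_ptorsion_finite :
  finite_set [set x : B | exists k, x *+ p ^ k = 0]%classic.
Proof.
have sfin := bassian_socle_finite.
pose inf_ht (x : B) n := exists y, x = y *+ p ^ n.
have decr n x : inf_ht x n.+1 -> inf_ht x n.
  by move=> [y ->]; exists (y *+ p); rewrite -mulrnA expnS.
have [DD DP] : exists N : zmodClosed B, forall x, x \in N <->
    (exists k, x *+ p ^ k = 0) /\ forall n, inf_ht x n.
  apply: zmodClosed_sg; split=> [|x y [[i xi] hx] [[j yj] hy]].
    split=> [|n]; first by exists 0%N; rewrite mul0rn.
    by exists 0; rewrite mul0rn.
  split=> [|n].
    exists (i + j)%N; rewrite mulrnBl expnD mulrnA xi [(p ^ i * _)%N]mulnC.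
    by rewrite mulrnA yj !mul0rn subrr.
  have [x' ->] := hx n; have [y' ->] := hy n; exists (x' - y').
  by rewrite mulrnBl.
pose D := subgroup DD.
have divp (d : D) : exists d', d = d' *+ p.
  have [[k dk] hd] := (DP (val d)).1 (valP d).
  have [|n x|n|y yd hy] := @finite_decreasing B
      [set y | y *+ p = val d]%classic (fun n y => inf_ht y n).
  - exact: finite_pdiv.
  - exact: decr.
  - have [y ey] := hd n.+1; exists (y *+ p ^ n); last by exists y.
    by rewrite /= -mulrnA -expnSr ey.
  have yD : y \in DD by apply/DP; split=> //; exists k.+1; rewrite expnS mulrnA yd.
  by exists (exist _ y yD); apply: val_inj; rewrite valMn -yd.
have [||d ed|b|psi psiP] :=
    @extend_additive B D 0 (fun z : B * D => z.1 = val z.2).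
- move=> l d pl _; have [->|lp] := eqVneq l p; first exact: divp.
  have [[k dk] _] := (DP (val d)).1 (valP d).
  apply: (@sg_coprime _ (fun d => exists d', d = d' *+ l) _ l (p ^ k)).
  + split=> [|_ _ [x ->] [z ->]]; first by exists 0; rewrite mul0rn.
    by exists (x - z); rewrite mulrnBl.
  + by rewrite coprimeXr // prime_coprime // dvdn_prime2.
  + by exists d.
  + by exists 0; rewrite mul0rn; apply: val_inj; rewrite valMn dk.
- by split=> [|x y /= -> ->]; rewrite ?raddf0 ?raddfB.
- by apply: val_inj; rewrite -ed raddf0.
- by [].
have psiD (d : D) : psi (val d) = d by apply: psiP.
have phiB : zmod_morphism (fun x => psi x *+ p).
  by move=> x y; rewrite raddfB mulrnBl.
pose phi : {additive B -> D} :=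
  HB.pack (fun x => psi x *+ p) (GRing.isZmodMorphism.Build _ _ _ phiB).
have DD0 x : x \in DD -> x *+ p = 0 -> x = 0.
  move=> xD xp; apply: (@bassian_surj_inj B D phi psi (fun x => x \in DD)) => //.
  - exact: sg_zmodClosed.
  - move=> d; have [d' ->] := divp d; exists (val d'); first exact: valP.
    by rewrite /phi /= psiD.
  - move=> c cD; rewrite -[c]/(val (exist _ c cD : D)) psiD => ->.
    by rewrite raddf0.
  - by rewrite /phi /= -raddfMn xp raddf0.
have [n hn] : exists n, forall x, x *+ p = 0 -> inf_ht x n -> x = 0.
  apply: contrapT => nex.
  have [|m x|m|x [x0 xp] hx] := @finite_decreasing B
      [set x | x <> 0 /\ x *+ p = 0]%classic (fun n x => inf_ht x n).
  - by apply: sub_finite_set sfin => x [].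
  - exact: decr.
  - apply: contrapT => h; apply: nex; exists m => x xp hx.
    by apply: contrapT => x0; apply: h; exists x.
  - apply: x0; apply: DD0 => //; apply/DP; split=> //; exists 1%N.
    by rewrite expn1.
apply: (@sub_finite_set _ _ [set x | x *+ p ^ n = 0]%classic).
  move=> x [k]; elim: k => [|k IH xk].
    by rewrite mulr1n => ->; rewrite /= mul0rn.
  have [kn|nk] := ltnP k n; first by apply: mulrn_dvd xk; rewrite dvdn_exp2l.
  apply: IH; apply: hn; first by rewrite -mulrnA -expnSr.
  by exists (x *+ p ^ (k - n)); rewrite -mulrnA -expnD subnK.
elim: (n) => [|m IH].
  by apply: sub_finite_set (finite_set1 0) => x; rewrite /= mulr1n.
apply: (@sub_finite_set _ _ (\bigcup_(y in [set y | y *+ p ^ m = 0])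
   [set x | x *+ p = y])%classic).
  by move=> x /= xm; exists (x *+ p) => //=; rewrite -mulrnA -expnS.
by apply: bigcup_finite => // y _; apply: finite_pdiv.
Qed.

End Socle.

(** * Embeddings into quotients and the splitting of the kernel *)

Lemma dvd_indep (G : zmodType) (c : nat -> G) :
  (forall k n, (0 < n)%N -> ~ nspan c k (c k *+ n)) -> indep_mod 0 0 c.
Proof.
move=> h k r b; rewrite mulr0n addr0 => /(sg_absz (sg_nspan c k)) rk.
rewrite dvd0z -absz_eq0 -leqn0 leqNgt; apply/negP => r0.
exact: (h k `|r|%N).
Qed.

Lemma bassian_fg (B : zmodType) : bassian B ->
  exists k (c : nat -> B), forall b, exists2 n, (0 < n)%N & nspan c k (b *+ n).
Proof.
move=> bB; apply: contrapT => nex.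
have [k s s' x /eq_nspan -> //|k s _|c cP] := @greedy B
  (fun k s x => forall n, (0 < n)%N -> ~ nspan s k (x *+ n)).
  apply: contrapT => nx; apply: nex; exists k, s => b.
  apply: contrapT => nb; apply: nx; exists b => n n0 hn; apply: nb.
  by exists n.
exact: (bassian_finite_rank bB (dvd_indep cP)).
Qed.

(** Let [K k] be the [k]-th iterated preimage of [0] under the correspondence
[pr y = f u], so that [c k] is in [K k.+1]. Since [f] is injective, [c k.+1 *~ r]
in [K k.+1] implies [c k *~ r] in [K k], and so on down to [x *~ r] in [K 0 = 0]. *)
Lemma iterate_embedding (G Q : zmodType) (f pr : {additive G -> Q})
    (W : set G) x :
  (forall y, f y = 0 -> y = 0) ->
  (forall w, W w -> exists2 w', W w' & pr w' = f w) ->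
  W x -> pr x = 0 ->
  exists c : nat -> G, (forall k, W (c k)) /\
    forall k r, nspan c k (c k *~ r) -> x *~ r = 0.
Proof.
move=> injf lift Wx x0.
have /choice[s sP] w : exists w', W w -> W w' /\ pr w' = f w.
  by have [/lift[w' ? ?]|] := pselect (W w); [exists w'|exists 0].
pose c := fun k => iter k s x.
have Wc k : W (c k) by elim: k => // k /sP[].
have cS k : pr (c k.+1) = f (c k) by case: (sP _ (Wc k)).
exists c; split=> //.
pose K := fix K k : set G := if k is k'.+1 then
  fun y => exists2 u, K k' u & pr y = f u else fun y => y = 0.
have sgK k : is_subgroup (K k).
  elim: k => [|k IH]; first by split=> [|y z /= -> ->]; rewrite ?subr0.
  split=> [|y z [u Ku eu] [v Kv ev]]; first by exists 0; rewrite ?raddf0 //; apply: sg0.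
  by exists (u - v); [apply: sgB|rewrite !raddfB eu ev].
have Kle i k : (i <= k)%N -> (K i `<=` K k)%classic.
  have KS j : (K j `<=` K j.+1)%classic.
    elim: j => [|j IH] y; first by move=> /= ->; exists 0; rewrite ?raddf0.
    by move=> [u /IH Ku eu]; exists u.
  by move=> /subnK <-; elim: (k - i)%N => // t IH y /IH /KS.
have cK k : K k.+1 (c k).
  elim: k => [|k IH]; first by exists 0; rewrite ?raddf0.
  by exists (c k).
move=> k r /(nspan_sub (sgK k) (fun i ik => Kle _ _ ik _ (cK i))) {cK}.
elim: k => // k IH [u Ku]; rewrite raddfMz /= cS -raddfMz => e; apply: IH.
suff -> : c k *~ r = u by [].
by apply/eqP; rewrite -subr_eq0; apply/eqP/injf; rewrite raddfB e subrr.
Qed.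

Section Embedding.
Variables (G Q : zmodType) (f pr : {additive G -> Q}).
Hypotheses (injf : forall y, f y = 0 -> y = 0)
  (surj : forall z, exists y, pr y = z).

Lemma kernel_torsion x :
  (forall c : nat -> G, ~ indep_mod 0 0 c) -> pr x = 0 ->
  exists2 n, (0 < n)%N & x *+ n = 0.
Proof.
move=> norank x0; apply: contrapT => ntor.
have [w _||c [_ cP]] := @iterate_embedding G Q f pr setT x injf _ _ x0 => //.
  by have [w' ew'] := surj (f w); exists w'.
apply: (norank c); apply: dvd_indep => k n n0 /(cP k n%:Z) xn.
by apply: ntor; exists n.
Qed.

(** The sequence of lifts of a nonzero [x] in the kernel would be injective. *)
Lemma kernel_finite (W : set G) x : finite_set W ->
  (forall w, W w -> exists2 w', W w' & pr w' = f w) ->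
  W x -> pr x = 0 -> x = 0.
Proof.
move=> /finite_seqP[s Ws] lift Wx x0; apply: contrapT => nx.
have [c [Wc cP]] := iterate_embedding injf lift Wx x0.
have ninj i j : (i < j)%N -> c i <> c j.
  move=> ij eij; apply: nx; apply: (cP j 1); rewrite mulr1z -eij.
  exact: nspan_mem.
have injc : injective c.
  move=> i j eij; case: (ltngtP i j) => // /ninj; first by move/(_ eij).
  by move/(_ (esym eij)).
suff : (size (map c (iota 0 (size s).+1)) <= size s)%N.
  by rewrite size_map size_iota ltnn.
apply: uniq_leq_size; first by rewrite map_inj_uniq ?iota_uniq.
by move=> _ /mapP[i _ ->]; have := Wc i; rewrite Ws.
Qed.

Definition pG_plus p (Z : set G) : set G :=
  fun x => exists y z, Z z /\ x = y *+ p + z.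

Lemma sg_pG_plus p Z : is_subgroup Z -> is_subgroup (pG_plus p Z).
Proof.
move=> sgZ; split=> [|_ _ [y [z [Zz ->]]] [y' [z' [Zz' ->]]]].
  by exists 0, 0; rewrite mul0rn addr0; split=> //; apply: sg0.
exists (y - y'), (z - z'); rewrite mulrnBl opprD addrACA; split=> //.
exact: sgB.
Qed.

Definition ptorsion p : set G := fun x => exists k, x *+ p ^ k = 0.

(** The finite set to which [kernel_finite] applies is the p-torsion of
[pG + Z]. A lift of [f w] in [pG + Z] has some multiple of order prime to [p]
in the kernel of [pr], since this kernel is torsion; subtracting the part of
order prime to [p] makes the lift p-torsion without changing its image. *)
Lemma kernel_disjoint p (Z : set G) x : prime p -> is_subgroup Z ->
  (forall y, pr y = 0 -> exists2 n, (0 < n)%N & y *+ n = 0) ->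
  (forall z, Z z -> exists2 y, pG_plus p Z y & pr y = f z) ->
  finite_set (ptorsion p `&` pG_plus p Z)%classic ->
  ptorsion p x -> pG_plus p Z x -> pr x = 0 -> x = 0.
Proof.
move=> pp sgZ tor liftZ finW xp xZ; apply: (kernel_finite finW) => //.
have sgpZ := sg_pG_plus p sgZ.
move=> w [[k wk] [y [z [Zz ew]]]].
have [y' ey'] := surj (f y); have [t' pt' et'] := liftZ z Zz.
pose t := y' *+ p + t'.
have Ht : pG_plus p Z t.
  apply: sgD => //; exists y', 0; rewrite addr0; split=> //; exact: sg0.
have prt : pr t = f w by rewrite ew /t !raddfD !raddfMn /= ey' et'.
have [|m m0 tm] := tor (t *+ p ^ k); first by rewrite raddfMn /= prt -raddfMn wk raddf0.
(* Here t *+ p ^ K is in the kernel, and t is killed by m' * p ^ K. *)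
have [m' cop em] := pfactor_coprime pp m0.
pose K := (k + logn p m)%N.
have pK : (0 < p ^ K)%N by rewrite expn_gt0 prime_gt0.
have prK : pr (t *+ p ^ K) = 0.
  by rewrite raddfMn /= prt -raddfMn expnD mulrnA wk mul0rn raddf0.
have tK : t *+ (m' * p ^ K) = 0.
  by rewrite mulnC /K expnD -mulnA [(_ * m')%N]mulnC -em mulrnA.
(* u * p ^ K = v * m' + 1, so t - t *+ (u * p ^ K) is killed by p ^ K. *)
case: (egcdnP m' pK) => u v e _.
have copK : coprime (p ^ K) m' by rewrite coprimeXl.
have ew' : t - t *+ (u * p ^ K) = - (t *+ (v * m')).
  by rewrite e (eqP copK) addn1 mulrS opprD addrA subrr add0r.
exists (t - t *+ (u * p ^ K)).
  split; last by apply: sgB => //; apply: sgMn.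
  exists K; rewrite ew' mulNrn -mulrnA -mulnA [(v * _)%N]mulnC mulrnA tK.
  by rewrite mul0rn oppr0.
by rewrite raddfB mulnC mulrnA raddfMn /= prK mul0rn subr0.
Qed.

End Embedding.

Section BplusE.
Variables (G : zmodType) (B F : zmodClosed G).
Hypotheses (BF : internal_dsum B F) (bB : bassian (subgroup B))
  (eF : elementary (subgroup F)).

Let in_sub (H : zmodClosed G) x (h : x \in H) : subgroup H := exist _ x h.

Lemma torsion_mod_B x : exists2 n, (0 < n)%N & x *+ n \in B.
Proof.
have [b [t [bB' tF ->]]] := BF.2 x.
have [n n0 /(congr1 val)] := eF.1 (in_sub tF); rewrite valMn /= => tn.
by exists n => //; rewrite mulrnDl tn addr0; apply: (sgMn (sg_zmodClosed B)).
Qed.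

(** Suitable multiples of the terms of an independent sequence lie in [B], and
they are again independent. *)
Lemma finite_rank (c : nat -> G) : ~ indep_mod 0 0 c.
Proof.
move=> ind; have /choice[n nP] k : exists n, (0 < n)%N /\ c k *+ n \in B.
  by have [n] := torsion_mod_B (c k); exists n.
pose c' k := in_sub (nP k).2.
apply: (bassian_finite_rank bB (c := c')); apply: dvd_indep => k t t0 [P sP].
move=> /(congr1 val); rewrite valMn (raddf_comb val) /= -mulrnA => e.
suff : (0%N %| (n k * t)%N%:Z)%Z.
  by rewrite dvd0z eqz_nat muln_eq0 !eqn0Ngt t0 (nP k).1.
apply: (ind k _ 0); rewrite addr0 -pmulrn e.
apply: (@nspan_sub _ (val \o c') k _ (sg_nspan c k)); last by exists P.
by move=> i ik; apply: (sgMn (sg_nspan c k)); apply: nspan_mem.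
Qed.

Lemma fg_full : exists k (z : nat -> G), (forall i, z i \in B) /\
  forall x, exists2 n, (0 < n)%N & nspan z k (x *+ n).
Proof.
have [k [c cP]] := bassian_fg bB; exists k, (val \o c); split.
  by move=> i; apply: valP.
move=> x; have [n n0 xB] := torsion_mod_B x.
have [m m0 [P sP /(congr1 val)]] := cP (in_sub xB).
rewrite valMn (raddf_comb val) /= -mulrnA => e.
by exists (n * m)%N; rewrite ?muln_gt0 ?n0 //; exists P.
Qed.

(** The component in [F] of such an element is [t *+ p] for a p-primary [t] in
[F], hence zero, so the set lies in the p-torsion of [B]. *)
Lemma ptorsion_pG_plus_finite p (Z : set G) : prime p ->
  (forall z, Z z -> z \in B) ->
  finite_set (ptorsion p `&` pG_plus p Z)%classic.
Proof.
move=> pp ZB.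
have := finite_image val (bassian_ptorsion_finite bB pp).
apply: sub_finite_set => x [[k xk] [y [z [/ZB zB ex]]]].
have [b [t [bB' tF ey]]] := BF.2 y.
have sgB' := sg_zmodClosed B; have sgF := sg_zmodClosed F.
have exy : y *+ p + z = (b *+ p + z) + t *+ p by rewrite ey mulrnDl addrAC.
have bzB : b *+ p + z \in B by apply: (sgD sgB') => //; apply: (sgMn sgB').
have tk : t *+ p ^ k.+1 = 0.
  apply: BF.1; last exact: (sgMn sgF).
  rewrite expnS mulrnA -[_ *+ p ^ k](addKr ((b *+ p + z) *+ p ^ k)) -mulrnDl.
  by rewrite -exy -ex xk addr0; apply: (sgN sgB'); apply: (sgMn sgB').
have tp : t *+ p = 0.
  have := eF.2 p pp (in_sub tF) => /(_ _)/(congr1 val); rewrite valMn; apply.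
  by exists k.+1; apply: val_inj; rewrite valMn.
have xB : x \in B by rewrite ex exy tp addr0.
exists (in_sub xB) => //; exists k; apply: val_inj; by rewrite valMn.
Qed.

End BplusE.

(** Linear algebra over the field with [p] elements in the quotient by [H]. *)
Lemma pcomplement (G : zmodType) (p : nat) (H M : set G) : prime p ->
  is_subgroup H -> is_subgroup M -> (forall x, H (x *+ p)) ->
  (forall x, H x -> M x -> x = 0) ->
  exists L, [/\ is_subgroup L, (H `<=` L)%classic,
    forall x, L x -> M x -> x = 0 &
    forall x, exists y m, [/\ L y, M m & x = y + m]].
Proof.
move=> pp sgH sgM pH HM.
have [L [sgL HL LM] l x y m pl Ly Mm e|L [[]]] := complement sgH sgM HM.
  have [lp|lp] := eqVneq l p.
    exists 0; first exact: sg0.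
    rewrite mul0rn; apply: LM => //; rewrite -[m](addKr y) -e.
    by apply: sgD => //; [apply: sgN|apply: HL; rewrite lp].
  have mp : m *+ p = 0 by apply: HM => //; apply: sgMn.
  suff [m' []] : exists m', M m' /\ m = m' *+ l by exists m'.
  apply: (@sg_coprime _ (fun m => exists m', M m' /\ m = m' *+ l) _ l p).
  - split=> [|_ _ [u [Mu ->]] [v [Mv ->]]].
      by exists 0; rewrite mul0rn; split=> //; apply: sg0.
    by exists (u - v); rewrite mulrnBl; split=> //; apply: sgB.
  - by rewrite prime_coprime // dvdn_prime2.
  - by exists m.
  - by exists 0; rewrite mul0rn mp; split=> //; apply: sg0.
by exists L.
Qed.

(** The subgroup [H p] separates the p-primary part of [N] and contains [pG], so
that part has a complement [L p] containing [H p]. The intersection of the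
[L p] complements [N], because each [x] lies in almost all of the [H p]: it is
enough to correct [x] by one element of the p-primary part of [N] for each of
finitely many primes. *)
Lemma torsion_summand (G : zmodType) (N : zmodClosed G) (H : nat -> set G) :
  (forall x, x \in N -> exists2 n, (0 < n)%N & x *+ n = 0) ->
  (forall p, prime p -> is_subgroup (H p)) ->
  (forall p x, prime p -> H p (x *+ p)) ->
  (forall p x, prime p -> H p x -> x \in N -> ptorsion p x -> x = 0) ->
  (forall x, exists2 n, (0 < n)%N & forall p, prime p -> coprime p n -> H p x) ->
  direct_summand N.
Proof.
move=> tor sgH pH HN Hae; have sgN' := sg_zmodClosed N.
pose Np p : set G := fun x => x \in N /\ ptorsion p x.
have sgNp p : is_subgroup (Np p).
  split=> [|x y [xN [i xi]] [yN [j yj]]].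
    by split; [exact: rpred0|exists 0%N; rewrite mul0rn].
  split; first exact: (sgB sgN').
  exists (i + j)%N; rewrite mulrnBl expnD mulrnA xi [(p ^ i * _)%N]mulnC.
  by rewrite mulrnA yj !mul0rn subrr.
have /choice[L LP] p : exists L : set G, prime p -> [/\ is_subgroup L,
    (H p `<=` L)%classic, forall x, L x -> Np p x -> x = 0 &
    forall x, exists y m, [/\ L y, Np p m & x = y + m]].
  have [pp|np] := boolP (prime p); last by exists set0.
  have [x Hx [xN xp]|L LP] := pcomplement pp (sgH p pp) (sgNp p) (fun x => pH p x pp).
    exact: (HN p).
  by exists L.
have [K KP] : exists K : zmodClosed G, forall x, x \in K <->
    forall p, prime p -> L p x.
  apply: zmodClosed_sg; split=> [p|x y hx hy p] pp; have [sgL _ _ _] := LP p pp.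
    exact: sg0.
  by apply: sgB => //; [apply: hx|apply: hy].
(* The p-primary part of N is r-divisible for r different from p. *)
have NpL p r x : prime p -> prime r -> p != r -> Np p x -> L r x.
  move=> pp pr pr' [_ [k xk]]; have [sgL HL _ _] := LP r pr.
  apply: (@sg_coprime _ _ sgL r (p ^ k)).
  - by rewrite coprimeXr // prime_coprime // dvdn_prime2 // eq_sym.
  - by apply: HL; apply: pH.
  - by rewrite xk; apply: sg0.
exists K; split=> [x xN /KP xK|x].
  have [n n0 xn] := tor x xN; elim/ltn_ind: n n0 xn => n IH n0 xn.
  have [n1|n1] := leqP n 1.
    by move: xn; rewrite (_ : n = 1)%N //; apply/eqP; rewrite eqn_leq n1.
  have pp := pdiv_prime n1; have [sgL _ LN _] := LP _ pp.
  apply: (IH (n %/ pdiv n)%N); first by rewrite ltn_Pdiv // prime_gt1.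
    by rewrite divn_gt0 ?pdiv_gt0 // dvdn_leq ?pdiv_dvd.
  apply: LN; first by apply: sgMn => //; apply: xK.
  split; first exact: (sgMn sgN').
  by exists 1%N; rewrite expn1 -mulrnA divnK ?pdiv_dvd.
(* Correction of x at the primes of s, without effect at the other primes. *)
have step s : uniq s -> all prime s -> exists y, [/\ y \in N,
    forall p, p \in s -> L p (x - y) &
    forall r, prime r -> r \notin s -> L r y].
  elim: s => [_ _|p s IH /= /andP[ps us] /andP[pp /[dup] ss /(IH us)]].
    exists 0; split=> // [|r pr _]; first exact: rpred0.
    by have [sgL _ _ _] := LP r pr; apply: sg0.
  move=> [y [yN ys ynr]]; have [sgL _ _ /(_ (x - y))[l [w [Ll Nw e]]]] := LP p pp.
  exists (y + w); split; first by apply: (sgD sgN') => //; case: Nw.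
    move=> r; rewrite inE => /orP[/eqP->|rs].
      by rewrite opprD addrA e addrK.
    have pr : prime r by apply: (allP ss).
    have [sgLr _ _ _] := LP r pr.
    rewrite opprD addrA; apply: sgB => //; first exact: ys.
    by apply: (NpL p) => //; apply: contraNneq ps => ->.
  move=> r pr; rewrite inE negb_or => /andP[rp rs].
  have [sgLr _ _ _] := LP r pr; apply: sgD => //; first exact: ynr.
  by apply: (NpL p) => //; rewrite eq_sym.
have [n n0 nP] := Hae x.
have [|y [yN ys ynr]] := step (primes n) (primes_uniq n).
  by apply/allP => p; rewrite mem_primes => /and3P[].
exists y, (x - y); split=> //; last by rewrite addrC subrK.
apply/KP => p pp; have [/ys//|pn] := boolP (p \in primes n).
have [sgL HL _ _] := LP p pp; apply: sgB => //; last exact: ynr.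
apply: HL; apply: nP => //; rewrite prime_coprime //.
by move: pn; rewrite mem_primes pp n0.
Qed.

(** For the primes dividing [m] the subgroup [pG] is used to separate the p-primary
part of [N], and [pG + Z] for the others; [Zp p] is the corresponding subgroup
[0] or [Z]. *)
Lemma BplusE_generalized_bassian (G : zmodType) :
  BplusE G -> generalized_bassian G.
Proof.
move=> [B [F [BF bB eF]]] N [f injf].
pose Q := Quotient.quot N; pose pr : {additive G -> Q} := \pi_Q.
have pr0 x : pr x = 0 <-> x \in N by rewrite -quot_eq0; split=> /eqP.
have f0 y : f y = 0 -> y = 0 by move=> fy; apply: injf; rewrite fy raddf0.
have surj z : exists y, pr y = z by exists (repr z); apply: reprK.
have tor x : pr x = 0 -> exists2 n, (0 < n)%N & x *+ n = 0.
  exact: (kernel_torsion f0 surj (finite_rank BF bB eF)).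
have [K [z [zB zfull]]] := fg_full BF bB eF.
pose Z := nspan z K; have sgZ : is_subgroup Z := sg_nspan z K.
have ZB x : Z x -> x \in B by apply: (nspan_sub (sg_zmodClosed B)) => i _.
have [m m0 mP] : exists2 m, (0 < m)%N &
    forall x, Z x -> exists2 y, Z (y *+ m) & pr y = f x.
  have /choice[n nP] i : exists n, (0 < n)%N /\ Z (repr (f (z i)) *+ n).
    by have [n] := zfull (repr (f (z i))); exists n.
  exists (\prod_(i < K) n i)%N; first by apply: prodn_gt0 => i; case: (nP i).
  apply: nspan_sub.
    split=> [|x y [x' Zx ex] [y' Zy ey]].
      by exists 0; rewrite ?mul0rn ?raddf0 //; apply: sg0.
    by exists (x' - y'); rewrite ?mulrnBl ?raddfB ?ex ?ey //; apply: sgB.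
  move=> i iK; exists (repr (f (z i))); last exact: reprK.
  rewrite (bigD1 (Ordinal iK)) //= mulrnA; apply: sgMn => //.
  by case: (nP i).
pose Zp p x := Z x /\ ((p %| m)%N -> x = 0).
have sgZp p : is_subgroup (Zp p).
  split=> [|x y [Zx x0] [Zy y0]]; first by split=> //; apply: sg0.
  by split=> [|pm]; [apply: sgB|rewrite x0 // y0 // subr0].
have pin p x : pG_plus p (Zp p) (x *+ p).
  by exists x, 0; rewrite addr0; split=> //; apply: sg0.
apply: (@torsion_summand G N (fun p => pG_plus p (Zp p))).
- by move=> x /pr0; apply: tor.
- by move=> p _; apply: sg_pG_plus.
- by move=> p x _; apply: pin.
- move=> p x pp xH /pr0 x0 xp.
  apply: (kernel_disjoint f0 surj pp (sgZp p) tor _ _ xp xH x0).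
    move=> y [Zy]; have [pm /(_ isT) -> |npm _] := boolP (p %| m)%N.
      by exists 0; rewrite ?raddf0 //; exact: (sg0 (sg_pG_plus p (sgZp p))).
    have [y' Zy' ey'] := mP y Zy; exists y' => //.
    apply: (sg_coprime (sg_pG_plus p (sgZp p)) (m := p) (n := m)) => //.
      by rewrite prime_coprime.
    exists 0, (y' *+ m); rewrite mul0rn add0r; split=> //; split=> //.
    by rewrite (negbTE npm).
  by apply: (ptorsion_pG_plus_finite BF bB eF pp) => y [/ZB].
- move=> x; have [n n0 Zn] := zfull x; exists (n * m)%N; first by rewrite muln_gt0 n0.
  move=> p pp; rewrite coprimeMr => /andP[cn cm].
  apply: (sg_coprime (sg_pG_plus p (sgZp p)) cn) => //.
  exists 0, (x *+ n); rewrite mul0rn add0r; split=> //; split=> //.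
  by move: cm; rewrite prime_coprime // => /negbTE ->.
Qed.

Theorem theorem3p8 (G : zmodType) (A E : zmodClosed G)
    (hG : BplusE G)
    (hAE : internal_dsum A E)
    (hE : elementary (subgroup E))
    (hA : forall S : zmodClosed (subgroup A),
       direct_summand S -> elementary (subgroup S) ->
       finite_set [set: subgroup S]%classic) :
  generalized_bassian G.
Proof. exact: BplusE_generalized_bassian hG. Qed.
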